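(* Let $\mathfrak{M}$ be a von Neumann algebra, let $A\in\mathfrak{M}$ be nonzero and positive, and let $P$ be the orthogonal projection onto $\overline{\mathcal{R}(A)}$. The following statements hold. (1) $\sigma_A(T)=\sigma(PT,P\mathfrak{M}P)$ for any $T\in\{A\}'$. In particular, if $\mathfrak{M}$ and $\mathfrak{N}$ are two von Neumann algebras such that $A\in\mathfrak{N}\subseteq\mathfrak{M}$, then $\sigma_A(T,\mathfrak{M})=\sigma_A(T,\mathfrak{N})$ for every $T\in\{A\}'\cap\mathfrak{N}$. (2) If $T\in\mathfrak{M}^A$ is algebraic, then $\sigma_A(T)=\sigma(PT,P\mathfrak{M}P)$.
   Context: Von Neumann algebras act on a complex Hilbert space $\mathcal{H}$ and contain the identity operator $I$ of $\mathcal{H}$; $\mathcal{R}(\cdot)$ denotes range; $P\in\mathfrak{M}$. For $h\in\mathcal{H}$ put $\|h\|_A=\sqrt{\langle Ah,h\rangle}$, for $T\in\mathfrak{M}$ put $\|T\|_A=\sup\{\|Th\|_A:\|h\|_A=1\}$, and set $\mathfrak{M}^A=\{T\in\mathfrak{M}:\|T\|_A<\infty\}$. For $T\in\mathfrak{M}^A$ one has $PT=PTP\in P\mathfrak{M}P$. $T\in\mathfrak{M}^A$ is $A$-invertible in $\mathfrak{M}^A$ if there is $S\in\mathfrak{M}^A$ with $ATS=AST=A$; the $A$-spectrum is $\sigma_A(T)=\sigma_A(T,\mathfrak{M})=\{\lambda\in\mathbb{C}:\lambda I-T\text{ is not }A\text{-invertible in }\mathfrak{M}^A\}$; $\sigma_A(T,\mathfrak{N})$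 is defined in the same way with $\mathfrak{N}$ in place of $\mathfrak{M}$. $\sigma(X,P\mathfrak{M}P)$ is the spectrum of $X$ in the algebra $P\mathfrak{M}P$ with unit $P$. Here $\{A\}'=\{T\in\mathcal{B}(\mathcal{H}):TA=AT\}\cap\mathfrak{M}$ is the commutant of $A$ in $\mathfrak{M}$; one has $\{A\}'\subseteq\mathfrak{M}^A$. An element $T$ is algebraic if $p(T)=0$ for some nonzero complex polynomial $p$. *)

(* Defs.v *)
From HB Require Import structures.
From mathcomp Require Import all_boot all_order all_algebra sesquilinear.
From mathcomp Require Import complex.
From mathcomp Require Import all_classical all_reals all_analysis.

Set Implicit Arguments.
Unset Strict Implicit.
Unset Printing Implicit Defensive.

Import Order.TTheory GRing.Theory Num.Theory.
Import numFieldNormedType.Exports.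

Local Open Scope classical_set_scope.
Local Open Scope complex_scope.
Local Open Scope ring_scope.

(* A complex Hilbert space is a complete normed module H over R[i] together
   with a positive definite Hermitian form, linear in its first argument,
   which induces the norm of H. Operators are plain functions H -> H, added and
   scaled pointwise and multiplied by composition. *)
Section Defs.
Context {R : realType} {H : completeNormedModType R[i]}.

Definition induces_norm (dot : {dot H for Num.conj}) : Prop :=
  forall h : H, dot h h = `|h| ^+ 2.

Definition bounded_operators : set (H -> H) :=
  [set T | linear T /\ continuous T].

Definition corner (P : H -> H) (M : set (H -> H)) : set (H -> H) :=
  [set P \o T \o P | T in M].

Definition commutant_in (M : set (H -> H)) (A : H -> H) : set (H -> H) :=
  [set T | M T /\ T \o A = A \o T].

Definition spectrum_in (B : set (H -> H)) (e X : H -> H) : set R[i] :=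
  [set l : R[i] | ~ exists2 Y, B Y &
     (l *: e - X) \o Y = e /\ Y \o (l *: e - X) = e].

Definition op_horner (p : {poly R[i]}) (T : H -> H) : H -> H :=
  \sum_(i < size p) p`_i *: iter i T.

Definition algebraic_op (T : H -> H) : Prop :=
  exists2 p : {poly R[i]}, p != 0 & op_horner p T = 0.

Section Dot.
Variable dot : {dot H for Num.conj}.

Definition is_adjoint (T S : H -> H) : Prop :=
  forall x y : H, dot (T x) y = dot x (S y).

(* Closedness in B(H) for the weak operator topology: the sets of all S with
   |<(S - T) x_j, y_j>| < e for j < n form a base of neighbourhoods of T. *)
Definition wot_closed (M : set (H -> H)) : Prop :=
  forall T : H -> H, bounded_operators T ->
    (forall (n : nat) (x y : 'I_n -> H) (e : R[i]), 0 < e ->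
       exists2 S, M S & forall j, `|dot ((S - T) (x j)) (y j)| < e) ->
    M T.

Record von_neumann_algebra (M : set (H -> H)) : Prop := VonNeumannAlgebra {
  vN_bounded : M `<=` bounded_operators;
  vN_id : M idfun;
  vN_add : forall S T, M S -> M T -> M (S + T);
  vN_scale : forall (a : R[i]) T, M T -> M (a *: T);
  vN_comp : forall S T, M S -> M T -> M (S \o T);
  vN_adjoint : forall T, M T -> exists2 S, M S & is_adjoint T S;
  vN_wot_closed : wot_closed M
}.

(* In R[i], [0 <= z] also says that z is real. *)
Definition positive_op (A : H -> H) : Prop := forall h : H, 0 <= dot (A h) h.

Definition orthogonal_projection (V : set H) (P : H -> H) : Prop :=
  forall h : H, V (P h) /\ forall k, V k -> dot (h - P h) k = 0.

Definition seminorm_by (A : H -> H) (h : H) : R :=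
  Num.sqrt (complex.Re (dot (A h) h)).

Definition op_seminorm_by (A T : H -> H) : \bar R :=
  ereal_sup [set (seminorm_by A (T h))%:E | h in [set h | seminorm_by A h = 1]].

Definition semibounded (M : set (H -> H)) (A : H -> H) : set (H -> H) :=
  [set T | M T /\ (op_seminorm_by A T < +oo)%E].

Definition semi_invertible (M : set (H -> H)) (A T : H -> H) : Prop :=
  exists2 S, semibounded M A S & A \o T \o S = A /\ A \o S \o T = A.

Definition semi_spectrum (M : set (H -> H)) (A T : H -> H) : set R[i] :=
  [set l : R[i] | ~ semi_invertible M A (l *: (idfun : H -> H) - T)].

End Dot.
End Defs.

(* Main.v *)
Require Import Defs.
From HB Require Import structures.
From mathcomp Require Import all_boot all_order all_algebra sesquilinear.
From mathcomp Require Import complex.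
From mathcomp Require Import all_classical all_reals all_analysis.
From mathcomp Require Import ring lra.
Import Order.TTheory GRing.Theory Num.Theory.
Import numFieldNormedType.Exports.

Local Open Scope classical_set_scope.
Local Open Scope complex_scope.
Local Open Scope ring_scope.

(** Write P for the projection onto the closed range of A and D for l - T. The
    operators T in question map ker A into itself, so that P D = P D P, and the
    equation A X = A Y just means P X = P Y. Hence an A-inverse S of D compresses
    to an inverse P S P of P D in the corner algebra. Conversely an inverse
    Y = P Z P of P D satisfies A D Y = A = A Y D, and what has to be found is an
    A-bounded solution in the algebra.
    - If T commutes with A then so does Y, and the commutant of A consists of
      A-bounded operators. This is Krein's inequality
      [<A Y h, Y h> <= |Y|^2 <A h, h>] (lemma [commuting_contraction_form]): for a
      contraction Y with adjoint S, the sequence <A (S Y)^n h, h> is convex and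
      bounded, hence nonincreasing; compare its first two terms.
    - If T is algebraic, Y need not be used: write a polynomial killing T as
      q * (X - l)^m with q(l) != 0. A left inverse of P D forces P q(T) = 0, and
      dividing q by X - l produces a polynomial in T which is an A-inverse of D
      (lemma [algebraic_left_inverse]); polynomials in T are A-bounded.

    Two facts of operator theory are needed: P lies in the von Neumann algebra,
    and the inverse of P D computed in the larger algebra M lies in N. Both come
    from the same approximation. If 0 <= F and F^2 <= F, then (1 - F)^n tends
    strongly to 0 on the range of F, because
    [|F x|^2 <= |x|^2 - |(1 - F) x|^2] telescopes along the iterates
    (lemma [iter_defect_range]). With F a multiple of A, the operators
    1 - (1 - F)^n tend to P. With F a multiple of X^* X for an operator X with
    inverse Y, the operators (1 - (1 - F)^n) Y tend to Y, and they are
    polynomials in X, X^* and P. No functional calculus or square root is used: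
    everything is done with quadratic forms, and it suffices to work with the
    real part of the inner product. *)

(** * The real inner product *)

Section RealForm.
Context {R : realType} {H : completeNormedModType R[i]}.
Variable dot : {dot H for Num.conj}.

Definition re_dot (u v : H) : R := complex.Re (dot u v).

Lemma dotDl u v w : dot (u + v) w = dot u w + dot v w.
Proof. exact: (linearDl dot). Qed.

Lemma dotDr u v w : dot w (u + v) = dot w u + dot w v.
Proof. exact: (linearDr dot). Qed.

Lemma dotZl a u v : dot (a *: u) v = a * dot u v.
Proof. by rewrite linearZl_LR. Qed.

Lemma dotZr a u v : dot u (a *: v) = (a^* )%R * dot u v.
Proof. by rewrite linearZr_LR. Qed.

Lemma re_dotDl u v w : re_dot (u + v) w = re_dot u w + re_dot v w.
Proof. by rewrite /re_dot linearDl /= raddfD. Qed.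

Lemma dotC u v : dot u v = (dot v u)^*.
Proof. by rewrite hermC expr0 mul1r. Qed.

Lemma re_dotC u v : re_dot u v = re_dot v u.
Proof. by rewrite /re_dot dotC; case: (dot v u). Qed.

Lemma re_dotDr u v w : re_dot w (u + v) = re_dot w u + re_dot w v.
Proof. by rewrite !(re_dotC w) re_dotDl. Qed.

Lemma re_dotZl (c : R) u v : re_dot (c%:C *: u) v = c * re_dot u v.
Proof.
by rewrite /re_dot linearZl_LR /=; case: (dot u v) => a b /=; rewrite mul0r subr0.
Qed.

Lemma re_dotZr (c : R) u v : re_dot u (c%:C *: v) = c * re_dot u v.
Proof. by rewrite re_dotC re_dotZl re_dotC. Qed.

Lemma re_dotNl u v : re_dot (- u) v = - re_dot u v.
Proof. by rewrite /re_dot linearNl /= raddfN. Qed.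

Lemma re_dotNr u v : re_dot u (- v) = - re_dot u v.
Proof. by rewrite re_dotC re_dotNl re_dotC. Qed.

Lemma re_dotBl u v w : re_dot (u - v) w = re_dot u w - re_dot v w.
Proof. by rewrite re_dotDl re_dotNl. Qed.

Lemma re_dotBr u v w : re_dot w (u - v) = re_dot w u - re_dot w v.
Proof. by rewrite re_dotDr re_dotNr. Qed.

Lemma re_dot0l u : re_dot 0 u = 0.
Proof. by rewrite /re_dot linear0l. Qed.

Lemma dot_sqE u : dot u u = (re_dot u u)%:C.
Proof.
have /ger0_Im := dnorm_ge0 dot u; rewrite /re_dot.
by case: (dot u u) => a b /= ->.
Qed.

Lemma sq_ge0 u : 0 <= re_dot u u.
Proof. by have := dnorm_ge0 dot u; rewrite dot_sqE ler0c. Qed.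

Lemma sq_eq0 u : re_dot u u = 0 -> u = 0.
Proof. by move=> u0; apply/eqP; rewrite -(dnorm_eq0 dot) dot_sqE u0. Qed.

(** Operator identities are checked against all vectors in the real form: it is
    still nondegenerate. *)
Lemma re_dot_inj u v : (forall w, re_dot w u = re_dot w v) -> u = v.
Proof.
move=> uv; apply/eqP; rewrite -subr_eq0; apply/eqP/sq_eq0.
by rewrite re_dotBr uv subrr.
Qed.

(** The crude forms of the Cauchy-Schwarz and triangle inequalities below lose a
    constant, but avoid square roots. *)
Lemma re_dot_le u v : re_dot u v <= re_dot u u + re_dot v v.
Proof.
have := sq_ge0 (u - v); rewrite !(re_dotBl, re_dotBr) (re_dotC v u).
have := sq_ge0 u; have := sq_ge0 v; lra.
Qed.

Lemma sqD_le u v :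
  re_dot (u + v) (u + v) <= 2 * re_dot u u + 2 * re_dot v v.
Proof.
have := sq_ge0 (u - v).
rewrite !(re_dotDl, re_dotDr, re_dotNl, re_dotNr) (re_dotC v u); lra.
Qed.

Lemma dot_CS u v : `|dot u v| ^+ 2 <= dot u u * dot v v.
Proof.
have [->|v0] := eqVneq v 0.
  by rewrite !(linear0r dot) normr0 mulr0 expr0n.
have dv : dot v v != 0 by rewrite dnorm_eq0.
pose a := dot u v / dot v v; pose w := u - a *: v.
have wv : dot w v = 0 by rewrite linearBl /= linearZl_LR /= divfK ?subrr.
have -> : dot u u = dot w w + `|a| ^+ 2 * dot v v.
  by rewrite -dnormZ -hnormDd ?subrK//= linearZr_LR/= wv mulr0.
rewrite mulrDl -mulrA -expr2.
rewrite -[in X in _ + _ * X](ger0_norm (dnorm_ge0 dot v)) -exprMn -normrM divfK//.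
by rewrite lerDr mulr_ge0 ?dnorm_ge0.
Qed.

Hypothesis dot_norm : induces_norm dot.

Lemma normE u : `|u| = (Num.sqrt (re_dot u u))%:C.
Proof.
apply/eqP; rewrite -(@eqrXn2 _ 2)// ?ler0c ?sqrtr_ge0//.
by rewrite -dot_norm dot_sqE -rmorphXn /= sqr_sqrtr ?sq_ge0.
Qed.

(** Operators are plain functions; this recovers the bundled linear map, on which
    the generic linearity lemmas apply. *)
Lemma linear_lift (T : H -> H) : linear T -> exists f : {linear H -> H}, T = f.
Proof.
move=> Tl; pose L := GRing.isLinear.Build _ _ _ _ T Tl.
by exists (HB.pack T L : {linear H -> H}).
Qed.

Lemma bounded_opP (T : H -> H) : bounded_operators T <->
  linear T /\ exists2 K : R, 0 < K & forall h, re_dot (T h) (T h) <= K * re_dot h h.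
Proof.
split=> -[Tl]; have [f Ef] := linear_lift _ Tl; subst T.
  move=> /linear_bounded_continuous/linear_boundedP/pinfty_ex_gt0[r r0 rP].
  split=> //; have rE : r = (complex.Re r)%:C by rewrite RRe_real ?gtr0_real.
  move: r0 rP; rewrite rE ltcR; move: (complex.Re r) => k k0 kP.
  (* K bounds squared norms, hence it is the square of an operator bound. *)
  exists (k ^+ 2); first exact: exprn_gt0.
  move=> h; have := kP h; rewrite !normE -rmorphM lecR => le1.
  rewrite -[leLHS]sqr_sqrtr ?sq_ge0// -[X in _ * X]sqr_sqrtr ?sq_ge0//.
  by rewrite -exprMn ler_pXn2r// nnegrE ?mulr_ge0 ?sqrtr_ge0 ?(ltW k0).
move=> [K K0 KP]; split=> //.
apply/linear_bounded_continuous/linear_boundedP.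
exists (Num.sqrt K)%:C; split; first by rewrite complex_real.
move=> r /ltW Kr h; apply: le_trans (ler_wpM2r (normr_ge0 h) Kr).
rewrite !normE -rmorphM lecR -sqrtrM ?(ltW K0)//.
by rewrite ler_sqrt ?mulr_ge0 ?sq_ge0 ?(ltW K0).
Qed.

End RealForm.

Local Notation re_dotE :=
  (re_dotDl, re_dotDr, re_dotNl, re_dotNr, re_dotZl, re_dotZr).

(** * Positive operators *)

Section RealOps.
Context {R : realType} {H : completeNormedModType R[i]}.
Variable dot : {dot H for Num.conj}.
Local Notation "<< u , v >>" := (re_dot dot u v).

Definition re_symmetric (T : H -> H) := forall x y, <<T x, y>> = <<x, T y>>.

(** Polarization: the form <A x, y> - <x, A y> vanishes on the diagonal, and over
    the complex numbers x + y and x + i y then determine it. *)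
Lemma positive_symmetric (A : H -> H) : linear A -> positive_op dot A ->
  forall x y, dot (A x) y = dot x (A y).
Proof.
move=> Al; have [f Ef] := linear_lift _ Al; subst A => fpos.
have f_re x : dot (f x) x = dot x (f x).
  by rewrite [RHS]dotC; apply/esym/CrealP/ger0_real/fpos.
move=> x y.
have pol (a : R[i]) : a^* * (dot (f x) y - dot x (f y)) +
    a * (dot (f y) x - dot y (f x)) = 0.
  have := f_re (x + a *: y); rewrite !linearD !linearZ /=.
  rewrite !(dotDl, dotDr, dotZl, dotZr) !f_re.
  move=> /eqP; rewrite -subr_eq0 => /eqP e0; rewrite -[RHS]e0; ring.
have := pol 1; have := pol 'i%C.
rewrite rmorph1 !mul1r.
have -> : ('i%C : R[i])^* = - 'i%C by simpc.
move=> e1 e2; have i0 : 'i%C != 0 :> R[i] by rewrite eq_complex /= oner_eq0 andbF.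
apply/eqP; rewrite -subr_eq0 -(mulIr_eq0 _ (mulIf (_ : 2 * 'i%C != 0))).
  apply/eqP; move: e1 e2; set p := _ - _; set q := _ - _ => e1 e2.
  have -> : p * (2 * 'i%C) = 'i%C * (p + q) - (- 'i%C * p + 'i%C * q) by ring.
  by rewrite e1 e2 mulr0 subr0.
by rewrite mulf_neq0 // pnatr_eq0.
Qed.

(** A^2 <= K A for a positive operator A. With A <= c, expand the nonnegative value
    of the form of A at h - c^-1 A h. *)
Lemma sq_le_form (A : H -> H) : bounded_operators A -> induces_norm dot ->
  re_symmetric A -> (forall h, 0 <= <<A h, h>>) ->
  exists2 K, 0 < K & forall h, <<A h, A h>> <= K * <<A h, h>>.
Proof.
move=> Ab dn Asym Apos; have [Al [K K0 KP]] := (bounded_opP _ dn _).1 Ab.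
have [f Ef] := linear_lift _ Al; subst A.
exists (K + 1); first by rewrite addr_gt0.
move=> h; set c := K + 1; have c0 : 0 < c by rewrite addr_gt0.
have le1 y : <<f y, y>> <= c * <<y, y>>.
  by have := re_dot_le dot (f y) y; have := KP y; rewrite /c mulrDl mul1r; lra.
have := Apos (h - c^-1%:C *: f h).
rewrite linearB linearZ /= !re_dotE (Asym (f h) h).
have := le1 (f h); move: (<<f (f h), _>>) (<<f h, f h>>) => p q le2 le3.
have le4 : c^-1 * (c^-1 * p) <= c^-1 * q.
  by rewrite ler_pM2l ?invr_gt0 // mulrC ler_pdivrMr // mulrC.
have : c^-1 * q <= <<f h, h>> by lra.
by rewrite mulrC ler_pdivrMr // mulrC.
Qed.

(** Here 0 <= f and f^2 <= f, and g = 1 - f is its defect. *)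
Section Defect.
Variables f g : {linear H -> H}.
Hypothesis gE : forall x, g x = x - f x.
Hypothesis f_le : forall x, <<f x, f x>> <= <<f x, x>>.

Lemma defect_le x : <<g x, g x>> <= <<x, x>> - <<f x, f x>>.
Proof.
by rewrite gE !re_dotE (re_dotC dot x); have := f_le x; lra.
Qed.

Lemma iter_linearB n u v : iter n g (u - v) = iter n g u - iter n g v.
Proof. by elim: n => //= n ->; rewrite linearB. Qed.

Lemma iter_defectC n k : iter n g (f k) = f (iter n g k).
Proof. by elim: n => //= n ->; rewrite !gE linearB. Qed.

Lemma iter_defect_le n x : <<iter n g x, iter n g x>> <= <<x, x>>.
Proof.
elim: n => //= n IH; apply: le_trans IH.
by apply: le_trans (defect_le _) _; rewrite gerBl sq_ge0.
Qed.

(** |g^n f k|^2 = |f g^n k|^2 is at most the difference of two consecutive terms of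
    the nonincreasing sequence |g^n k|^2, which converges. *)
Lemma iter_defect_range k :
  <<iter n g (f k), iter n g (f k)>> @[n --> \oo] --> (0 : R).
Proof.
pose a n := <<iter n g k, iter n g k>>.
have a_dec : nonincreasing_seq a.
  apply/nonincreasing_seqP => n; rewrite /a /=.
  by apply: le_trans (defect_le _) _; rewrite gerBl sq_ge0.
have /cvg_ex[l al] : cvgn a.
  apply: nonincreasing_is_cvgn => //; exists 0 => _ [n _ <-]; exact: sq_ge0.
have dl : a n - a n.+1 @[n --> \oo] --> (0 : R).
  by rewrite -[X in _ --> X](subrr l); apply: cvgB => //; rewrite cvg_shiftS.
apply: squeeze_cvgr (cvg_cst 0) dl; apply: nearW => n.
rewrite sq_ge0 iter_defectC /=.
by have := defect_le (iter n g k); rewrite /a /=; lra.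
Qed.

(** The iterates of g are contractions, so convergence extends to the closure of the
    range of f. *)
Lemma iter_defect_closure v : (forall e, 0 < e -> exists k, <<v - f k, v - f k>> < e) ->
  <<iter n g v, iter n g v>> @[n --> \oo] --> (0 : R).
Proof.
move=> vP; apply/cvgrPdist_lt => e e0.
have [|k kP] := vP (e / 4); first by rewrite divr_gt0.
have /cvgrPdist_lt/(_ (e / 4)) := iter_defect_range k.
move=> /(_ (divr_gt0 e0 (ltr0Sn _ 3))); apply: filterS => n.
rewrite !sub0r !normrN !ger0_norm ?sq_ge0// => le1.
have -> : iter n g v = iter n g (v - f k) + iter n g (f k).
  by rewrite iter_linearB subrK.
apply: le_lt_trans (sqD_le _ _ _) _.
have := iter_defect_le n (v - f k); lra.
Qed.
End Defect.

(** The increments of a convex sequence are nondecreasing: were the first one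
    positive, the sequence would grow at least linearly. *)
Lemma convex_bounded_decreasing (b : nat -> R) (C : R) :
  (forall n, 0 <= b n - 2 * b n.+1 + b n.+2) -> (forall n, b n <= C) -> b 1 <= b 0.
Proof.
move=> bconv bC; rewrite leNgt; apply/negP => lt01.
have incr n : b 1 - b 0 <= b n.+1 - b n.
  by elim: n => // n IH; have := bconv n; lra.
have lin n : b 0 + (b 1 - b 0) *+ n <= b n.
  elim: n => [|n IH]; first by rewrite mulr0n addr0.
  by rewrite mulrSr; have := incr n; lra.
have [n nP] : exists n : nat, C - b 0 < (b 1 - b 0) *+ n.
  exists (Num.bound `|(C - b 0) / (b 1 - b 0)|).
  have d0 : 0 < b 1 - b 0 by rewrite subr_gt0.
  rewrite -[ltRHS]mulr_natl -ltr_pdivrMr //.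
  by apply: le_lt_trans (ler_norm _) (archi_boundP (normr_ge0 _)).
by have := lin n; have := bC n; lra.
Qed.

(** Krein's inequality for a contraction Y commuting, together with its adjoint S,
    with the positive operator A. Below X n is (S Y)^n; even and odd
    powers of S Y have the forms Z^* Z and Z^* (S Y) Z, so <A X n h, h> is always
    nonnegative, and evaluating them at h - S Y h gives a convex sequence. *)
Section Krein.
Variables (A Y S : {linear H -> H}) (K : R).
Hypothesis A_pos : forall h, 0 <= <<A h, h>>.
Hypothesis A_bnd : forall h, <<A h, A h>> <= K * <<h, h>>.
Hypothesis K_ge0 : 0 <= K.
Hypothesis AY : forall x, A (Y x) = Y (A x).
Hypothesis AS : forall x, A (S x) = S (A x).
Hypothesis YS : forall x y, <<Y x, y>> = <<x, S y>>.
Hypothesis Y_le : forall h, <<Y h, Y h>> <= <<h, h>>.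
Hypothesis S_le : forall h, <<S h, S h>> <= <<h, h>>.

Let X n h := iter n (fun h => S (Y h)) h.

Let SY u v : <<S u, v>> = <<u, Y v>>.
Proof. by rewrite re_dotC -YS re_dotC. Qed.

Let XA n h : A (X n h) = X n (A h).
Proof. by elim: n => //= n IH; rewrite AS AY IH. Qed.

Let XB n u v : X n (u - v) = X n u - X n v.
Proof. by elim: n => //= n ->; rewrite !linearB. Qed.

Let X_sym n u v : <<X n u, v>> = <<u, X n v>>.
Proof.
elim: n u v => //= n IH u v.
by rewrite SY YS IH /X -[S (Y (iter n _ v))]/(iter n.+1 (fun h => S (Y h)) v) iterSr.
Qed.

Let X_pos n h : 0 <= <<A (X n h), h>>.
Proof.
move: h; apply: (@proj1 _ (forall h, 0 <= <<A (X n.+1 h), h>>)).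
elim: n => [|n [IH1 IH2]]; split=> h //.
  by rewrite /= AS SY; apply: A_pos.
have -> : X n.+2 h = X 1 (X n (X 1 h)) by rewrite /X -!iterD addn1.
by rewrite XA X_sym; apply: IH1.
Qed.

Lemma commuting_contraction_form h : <<A (Y h), Y h>> <= <<A h, h>>.
Proof.
pose b n := <<A (X n h), h>>.
have b1 : b 1 = <<A (Y h), Y h>> by rewrite /b /= AS SY.
rewrite -b1; apply: (convex_bounded_decreasing b (K * <<h, h>> + <<h, h>>)).
  move=> n; have := X_pos n (h - X 1 h); rewrite XB linearB /= !re_dotE.
  have -> : <<A (X n (X 1 h)), X 1 h>> = b n.+2.
    by rewrite -X_sym -XA /X -!iterD /b addn1.
  have -> : <<A (X n h), X 1 h>> = b n.+1 by rewrite -X_sym -XA.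
  have -> : <<A (X n (X 1 h)), h>> = b n.+1 by rewrite /X -iterD addn1.
  by rewrite /b; lra.
have X_le n : <<X n h, X n h>> <= <<h, h>>.
  elim: n => //= n IH; apply: le_trans IH.
  exact: le_trans (S_le _) (Y_le _).
move=> n; apply: le_trans (re_dot_le _ _ _) _; rewrite lerD2r.
by apply: le_trans (A_bnd _) _; rewrite ler_wpM2l.
Qed.
End Krein.

End RealOps.

(** * Von Neumann algebras and the range projection *)

Section VonNeumann.
Context {R : realType} {H : completeNormedModType R[i]}.
Variable dot : {dot H for Num.conj}.
Hypothesis dot_norm : induces_norm dot.
Local Notation "<< u , v >>" := (re_dot dot u v).

Lemma adjoint_re (T S : H -> H) : is_adjoint dot T S ->
  forall x y, <<T x, y>> = <<x, S y>>.
Proof. by move=> TS x y; rewrite /re_dot TS. Qed.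

Section Algebra.
Variable M : set (H -> H).
Hypothesis M_vN : von_neumann_algebra dot M.

Lemma vN_sub S T : M S -> M T -> M (S - T).
Proof.
move=> MS MT; rewrite -scaleN1r; exact: (vN_add M_vN MS (vN_scale M_vN _ MT)).
Qed.

Lemma vN_zero : M 0.
Proof. by have := vN_sub _ _ (vN_id M_vN) (vN_id M_vN); rewrite subrr. Qed.

Lemma vN_iter n T : M T -> M (iter n T).
Proof.
move=> MT; elim: n => [|n IH]; first exact: (vN_id M_vN).
exact: (vN_comp M_vN MT IH).
Qed.

Lemma vN_linear T : M T -> exists f : {linear H -> H}, T = f.
Proof. by move=> /(vN_bounded M_vN)[Tl _]; apply: linear_lift. Qed.

(** Strong convergence of a sequence implies weak operator convergence, by
    Cauchy-Schwarz. *)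
Lemma vN_strong_limit (S_ : nat -> H -> H) T :
  (forall n, M (S_ n)) -> bounded_operators T ->
  (forall h, <<S_ n h - T h, S_ n h - T h>> @[n --> \oo] --> (0 : R)) -> M T.
Proof.
move=> MS Tb ST; apply: (vN_wot_closed M_vN) => // n x y e e0.
have eE : e = (complex.Re e)%:C by rewrite RRe_real ?gtr0_real.
move: e0; rewrite eE ltcR; move: (complex.Re e) => {}e {eE} e0.
have : \forall m \near \oo, forall j : 'I_n,
    <<S_ m (x j) - T (x j), S_ m (x j) - T (x j)>> * (<<y j, y j>> + 1) < e ^+ 2.
  apply: filter_forall => j.
  have yj : 0 < <<y j, y j>> + 1 by rewrite ltr_wpDl ?sq_ge0.
  have /cvgrPdist_lt/(_ (e ^+ 2 / (<<y j, y j>> + 1))) := ST (x j).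
  move=> /(_ (divr_gt0 (exprn_gt0 _ e0) yj)); apply: filterS => m.
  by rewrite sub0r normrN ger0_norm ?sq_ge0// ltr_pdivlMr.
move=> /filter_ex[m mP]; exists (S_ m) => // j.
rewrite -(@ltr_pXn2r _ 2)// ?nnegrE ?ler0c ?(ltW e0)//.
apply: le_lt_trans (dot_CS _ _ _) _.
rewrite !dot_sqE -rmorphM -rmorphXn ltcR; apply: le_lt_trans (mP j).
by rewrite ler_wpM2l ?sq_ge0 // lerDl.
Qed.

End Algebra.

Section Projection.
Variables (A : {linear H -> H}) (P : H -> H).
Hypothesis A_sym : re_symmetric dot A.
Hypothesis P_proj : orthogonal_projection dot (closure (range A)) P.

Lemma closure_range_approx v : closure (range A) v ->
  forall e, 0 < e -> exists k, <<v - A k, v - A k>> < e.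
Proof.
move=> cv e e0.
have se : 0 < (Num.sqrt e)%:C :> R[i] by rewrite ltcR sqrtr_gt0.
have [_ [[k _ <-] kv]] := cv _ (nbhsx_ballx v _ se).
exists k; move: kv; rewrite -ball_normE /= (normE _ dot_norm) ltcR.
by rewrite ltr_sqrt.
Qed.

(** Cauchy-Schwarz in disguise: if c = <v, k> were nonzero, testing v - A w against
    a well-chosen multiple t k of k bounds |v - A w| away from 0. *)
Lemma closure_range_perp_ker v k : closure (range A) v -> A k = 0 -> <<v, k>> = 0.
Proof.
move=> cv Ak; set c := <<v, k>>; pose s := <<k, k>> + 1.
have s0 : 0 < s by rewrite ltr_wpDl ?sq_ge0.
apply/eqP/negPn/negP => c0; pose t := c / s.
have t0 : t != 0 by rewrite mulf_neq0 ?invr_eq0 ?(gt_eqF s0).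
have [|w] := closure_range_approx _ cv (t ^+ 2); first by rewrite exprn_even_gt0.
have := re_dot_le dot (v - A w) (t%:C *: k); rewrite !re_dotZl !re_dotZr.
rewrite re_dotBl A_sym Ak.
have -> : <<w, 0>> = 0 by rewrite re_dotC re_dot0l.
rewrite subr0 -/c; have -> : c = t * s by rewrite /t divfK ?gt_eqF.
by rewrite /s expr2; nra.
Qed.

Lemma proj_perp h k : closure (range A) k -> <<h - P h, k>> = 0.
Proof. by move=> ck; rewrite /re_dot (P_proj h).2. Qed.

Lemma proj_closure h : closure (range A) (P h).
Proof. exact: (P_proj h).1. Qed.

Lemma A_proj h : A (P h) = A h.
Proof.
apply/eqP; rewrite eq_sym -subr_eq0 -linearB; apply/eqP/(re_dot_inj dot) => w.
rewrite -A_sym re_dotC proj_perp; last by apply: subset_closure; exists w.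
by rewrite re_dotC re_dot0l.
Qed.

(** The defect of linearity is killed by A, and it is a combination of values of P,
    which are orthogonal to ker A; so it is orthogonal to itself. *)
Lemma proj_linear : linear P.
Proof.
move=> a h k; apply/eqP; rewrite -subr_eq0; set u := _ - _; apply/eqP.
have Au : A u = 0.
  by rewrite /u linearB linearP !A_proj linearP subrr.
have ker_perp v : <<P v, u>> = 0 := closure_range_perp_ker _ _ (proj_closure v) Au.
have ker_perpZ v : <<a *: P v, u>> = 0.
  have -> : <<a *: P v, u>> = <<P v, a^* *: u>>.
    by rewrite /re_dot dotZl dotZr conjCK.
  by apply: closure_range_perp_ker (proj_closure v) _; rewrite linearZ /= Au scaler0.
apply: (sq_eq0 dot); change (<<P (a *: h + k) - (a *: P h + P k), u>> = 0).
by rewrite re_dotBl re_dotDl !ker_perp ker_perpZ addr0 subrr.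
Qed.

Lemma proj_ker h : A h = 0 -> P h = 0.
Proof.
move=> Ah; apply: (sq_eq0 dot); apply: closure_range_perp_ker (proj_closure h) _.
by rewrite A_proj.
Qed.

(** A is injective on the range of P: this is what turns identities after A into
    identities after P. *)
Lemma proj_eq h k : A h = A k -> P h = P k.
Proof.
move=> hk; have [p pE] := linear_lift _ proj_linear.
apply/eqP; rewrite -subr_eq0 pE -linearB -pE proj_ker //.
by rewrite linearB /= hk subrr.
Qed.

Lemma projK h : P (P h) = P h.
Proof. exact/proj_eq/A_proj. Qed.

Lemma proj_A h : P (A h) = A h.
Proof.
apply/eqP; rewrite eq_sym -subr_eq0; apply/eqP; set u := _ - _.
have Au : A u = 0 by rewrite /u linearB /= A_proj subrr.
apply: (sq_eq0 dot); change (<<A h - P (A h), u>> = 0); rewrite re_dotBl.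
rewrite !(closure_range_perp_ker _ u) ?subrr //; first exact: proj_closure.
by apply: subset_closure; exists h.
Qed.

Lemma proj_symmetric : re_symmetric dot P.
Proof.
move=> x y; have := proj_perp x _ (proj_closure y).
have := proj_perp y _ (proj_closure x); rewrite !re_dotBl.
by rewrite (re_dotC dot y) (re_dotC dot (P y)); lra.
Qed.

Lemma proj_le h : <<P h, P h>> <= <<h, h>>.
Proof.
have := sq_ge0 dot (h - P h); have := proj_perp h _ (proj_closure h).
by rewrite !re_dotE (re_dotC dot (P h) h); lra.
Qed.

Lemma proj_bounded : bounded_operators P.
Proof.
apply/(bounded_opP _ dot_norm); split; first exact: proj_linear.
by exists 1 => // h; rewrite mul1r; apply: proj_le.
Qed.

End Projection.

End VonNeumann.

(** * Elements of a von Neumann algebra obtained as strong limits *)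

Section Forms.
Context {R : realType} {H : completeNormedModType R[i]}.
Variable dot : {dot H for Num.conj}.
Hypothesis dot_norm : induces_norm dot.
Local Notation "<< u , v >>" := (re_dot dot u v).
Variable M : set (H -> H).
Hypothesis M_vN : von_neumann_algebra dot M.

Lemma vN_bounded_const T : M T ->
  exists2 K, 0 < K & forall h, <<T h, T h>> <= K * <<h, h>>.
Proof. by move=> /(vN_bounded M_vN)/(bounded_opP _ dot_norm)[]. Qed.

(** A positive operator becomes f with f^2 <= f after division by the constant K of
    [sq_le_form]; the defect g = 1 - f is what the approximations iterate. *)
Lemma vN_defect W : M W -> re_symmetric dot W -> (forall h, 0 <= <<W h, h>>) ->
  exists f g : {linear H -> H}, exists2 K, 0 < K &
    [/\ M g, forall x, f x = K^-1%:C *: W x, forall x, g x = x - f x &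
        forall x, <<f x, f x>> <= <<f x, x>>].
Proof.
move=> MW Wsym Wpos.
have [K K0 KP] := sq_le_form _ _ (vN_bounded M_vN MW) dot_norm Wsym Wpos.
have MF : M (K^-1%:C *: W) by exact: (vN_scale M_vN).
have MG : M (idfun - K^-1%:C *: W) by exact: (vN_sub _ _ M_vN _ _ (vN_id M_vN) MF).
have [f fE] := vN_linear _ _ M_vN _ MF.
have [g gE] := vN_linear _ _ M_vN _ MG.
have fW x : f x = K^-1%:C *: W x by rewrite -fE.
exists f, g, K => //; split=> // [|x|x]; first by rewrite -gE.
  by rewrite -gE -fE.
rewrite fW !re_dotE ler_pM2l ?invr_gt0 // mulrC ler_pdivrMr // mulrC.
exact: KP.
Qed.

(** If X has the inverse Y in the corner P B(H) P, then Y is the strong limit of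
    (1 - g^n) Y, where g = 1 - X^* X / K: these are in M because (1 - g) Y is a
    multiple of X^* P, and g^n Y tends to 0 because Y maps into the range of
    X^* X. *)
Lemma vN_spectral_permanence P X Y Y' : M P -> M X -> bounded_operators Y ->
  is_adjoint dot Y Y' -> re_symmetric dot P ->
  X \o Y = P -> Y \o X = P -> Y \o P = Y -> P \o Y = Y -> M Y.
Proof.
move=> MP MX Yb YY' Psym XY YX YP PY.
have [X' MX' XX'] := vN_adjoint M_vN MX.
have X'X u v : <<X' u, v>> = <<u, X v>>.
  by rewrite re_dotC -(adjoint_re _ _ _ XX') re_dotC.
have Wsym : re_symmetric dot (X' \o X).
  by move=> x y /=; rewrite X'X (adjoint_re _ _ _ XX').
have Wpos h : 0 <= <<(X' \o X) h, h>> by rewrite /= X'X sq_ge0.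
have [f [g [K K0 [Mg fX gf f_le]]]] := vN_defect _ (vN_comp M_vN MX' MX) Wsym Wpos.
have fY x : f (Y x) = K^-1%:C *: X' (P x) by rewrite fX /= -[X (Y x)]/((X \o Y) x) XY.
(* X^* X Y Y^* Y = X^* Y^* Y = (Y X)^* Y = P Y, so Y maps into the range of f. *)
have Y_range h : Y h = f (K%:C *: Y (Y' (Y h))).
  have [y yE] := linear_lift _ Yb.1.
  rewrite linearZ /= fY scalerA -rmorphM divff ?gt_eqF // scale1r.
  apply: (re_dot_inj dot) => w.
  rewrite -(adjoint_re _ _ _ XX') -Psym -(adjoint_re _ _ _ YY').
  have -> : Y (P (X w)) = P w by rewrite -[LHS]/((Y \o P) (X w)) YP -YX.
  by rewrite Psym -[P (Y h)]/((P \o Y) h) PY.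
(* These lie in M since each increment is g^n f Y, where f Y is a multiple of X^* P. *)
pose Q n : H -> H := (idfun - iter n g) \o Y.
have Mgn n : M (iter n g) by exact: (vN_iter _ _ M_vN).
have MQ n : M (Q n).
  elim: n => [|n IH].
    suff -> : Q 0 = 0 by exact: (vN_zero _ _ M_vN).
    by apply/funext => h; rewrite /Q /= fctE subrr.
  suff -> : Q n.+1 = Q n + (iter n g \o (K^-1%:C *: (X' \o P))).
    apply: (vN_add M_vN) => //; apply: (vN_comp M_vN) => //.
    by apply: (vN_scale M_vN); apply: (vN_comp M_vN).
  apply/funext => h; rewrite /Q /= !fctE -fY iterSr.
  by rewrite gf iter_linearB opprB addrA addrAC.
apply: (vN_strong_limit _ _ M_vN Q) => // h.
have := iter_defect_range dot f g gf f_le (K%:C *: Y (Y' (Y h))).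
rewrite -Y_range; apply: cvg_trans; apply: near_eq_cvg; apply: nearW => n.
by rewrite /Q /= fctE addrAC subrr add0r re_dotNl re_dotNr opprK.
Qed.

Section Positive.
Variable A : {linear H -> H}.
Hypothesis MA : M A.
Hypothesis A_sym : re_symmetric dot A.
Hypothesis A_pos : forall h, 0 <= <<A h, h>>.

(** The operators 1 - g^n, with g = 1 - A / K, vanish on ker A and tend to the identity
    on the closed range of A. *)
Lemma vN_projection P :
  orthogonal_projection dot (closure (range A)) P -> M P.
Proof.
move=> P_proj.
have [f [g [K K0 [Mg fX gf f_le]]]] := vN_defect _ MA A_sym A_pos.
apply: (vN_strong_limit _ _ M_vN (fun n => idfun - iter n g)).
- move=> n; apply: (vN_sub _ _ M_vN _ _ (vN_id M_vN)).
  exact: (vN_iter _ _ M_vN).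
- exact: (proj_bounded _ dot_norm A).
move=> h.
have gker n : iter n g (h - P h) = h - P h.
  elim: n => //= n ->; rewrite gf fX linearB /= (A_proj dot A P A_sym P_proj).
  by rewrite subrr scaler0 subr0.
have : <<iter n g (P h), iter n g (P h)>> @[n --> \oo] --> (0 : R).
  apply: (iter_defect_closure _ f g gf f_le) => e e0.
  have [k kP] := closure_range_approx _ dot_norm A _ (proj_closure _ _ _ P_proj h) e e0.
  exists (K%:C *: k).
  by rewrite linearZ /= fX scalerA -rmorphM divff ?gt_eqF // scale1r.
apply: cvg_trans; apply: near_eq_cvg; apply: nearW => n.
rewrite !fctE.
have -> : h - iter n g h - P h = - iter n g (P h).
  have -> : iter n g h = h - P h + iter n g (P h).
    by rewrite -(gker n) iter_linearB subrK.
  by rewrite opprD addrA opprB addrCA subrr addr0 addrAC subrr add0r.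
by rewrite re_dotNl re_dotNr opprK.
Qed.

(** * Boundedness for the seminorm of A *)

(** T is bounded for the seminorm of A, expressed on squares. In this form closure
    under sums needs no triangle inequality for the seminorm. *)
Definition form_bounded (T : H -> H) :=
  exists2 C, 0 <= C & forall h, <<A (T h), T h>> <= C * <<A h, h>>.

Lemma formD_le u v : <<A (u + v), u + v>> <= 2 * <<A u, u>> + 2 * <<A v, v>>.
Proof. by have := A_pos (u - v); rewrite linearB linearD !re_dotE; lra. Qed.

Lemma form_eq0 h : <<A h, h>> = 0 -> A h = 0.
Proof.
have [K K0 KP] := sq_le_form _ _ (vN_bounded M_vN MA) dot_norm A_sym A_pos.
move=> h0; apply: (sq_eq0 dot); apply/eqP; rewrite eq_le sq_ge0 andbT.
by have := KP h; rewrite h0 mulr0.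
Qed.

Lemma formZ a u :
  <<A (a *: u), a *: u>> = (complex.Re a ^+ 2 + complex.Im a ^+ 2) * <<A u, u>>.
Proof.
rewrite /re_dot [A _]linearZ /= dotZl dotZr mulrA -normCK.
by rewrite -add_Re2_Im2; case: (dot _ _) => x y /=; rewrite mul0r subr0.
Qed.

Lemma form_bounded_id : form_bounded idfun.
Proof. by exists 1 => // h; rewrite mul1r. Qed.

Lemma form_boundedD S T : form_bounded S -> form_bounded T -> form_bounded (S + T).
Proof.
move=> [C C0 CP] [D D0 DP]; exists (2 * C + 2 * D); first by lra.
by move=> h; apply: le_trans (formD_le _ _) _; have := CP h; have := DP h; nra.
Qed.

Lemma form_boundedZ a T : form_bounded T -> form_bounded (a *: T).
Proof.
move=> [C C0 CP]; have a0 : 0 <= complex.Re a ^+ 2 + complex.Im a ^+ 2.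
  by rewrite addr_ge0 ?sqr_ge0.
exists ((complex.Re a ^+ 2 + complex.Im a ^+ 2) * C); first exact: mulr_ge0.
by move=> h; rewrite fctE formZ -mulrA ler_wpM2l.
Qed.

Lemma form_bounded_comp S T :
  form_bounded S -> form_bounded T -> form_bounded (S \o T).
Proof.
move=> [C C0 CP] [D D0 DP]; exists (C * D); first exact: mulr_ge0.
move=> h /=; apply: le_trans (CP _) _.
by rewrite -mulrA ler_wpM2l.
Qed.

Lemma form_bounded_ker T h : form_bounded T -> A h = 0 -> A (T h) = 0.
Proof.
move=> [C C0 CP] Ah; apply: form_eq0; apply/eqP; rewrite eq_le A_pos andbT.
by have := CP h; rewrite Ah re_dot0l mulr0.
Qed.

(** Krein's inequality, after scaling Y and its adjoint S to contractions. *)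
Lemma commutant_form_bounded Y : M Y -> Y \o A = A \o Y -> form_bounded Y.
Proof.
move=> MY YA; have [S MS YS] := vN_adjoint M_vN MY.
have [K1 K10 K1P] := vN_bounded_const _ MY.
have [K2 K20 K2P] := vN_bounded_const _ MS.
have [K K0 KP] := vN_bounded_const _ MA.
pose c := (1 + K1 + K2)^-1.
have d0 : 0 < 1 + K1 + K2 by lra.
have c0 : 0 < c by rewrite invr_gt0.
have c1 : c * (1 + K1 + K2) = 1 by rewrite mulVf ?gt_eqF.
have [y yE] := vN_linear _ _ M_vN _ (vN_scale M_vN c%:C MY).
have [s sE] := vN_linear _ _ M_vN _ (vN_scale M_vN c%:C MS).
have yY x : y x = c%:C *: Y x by rewrite -yE.
have sS x : s x = c%:C *: S x by rewrite -sE.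
have AY x : A (Y x) = Y (A x) by rewrite -[RHS]/((Y \o A) x) YA.
have AS x : A (S x) = S (A x).
  apply: (re_dot_inj dot) => w.
  by rewrite -A_sym -!(adjoint_re _ _ _ YS) -AY A_sym.
have contr K' (p q : R) : 0 <= q -> p <= K' * q -> 0 < K' -> K' <= K1 + K2 ->
    c * (c * p) <= q.
  move=> q0 pq K'0 K'K.
  have c_le1 : c <= 1 by nra.
  have cK : c * K' <= 1 by nra.
  have le1 : c * p <= q.
    apply: le_trans (ler_wpM2l (ltW c0) pq) _.
    by rewrite mulrA ler_piMl.
  by nra.
exists (c^-1 * c^-1) => [|h]; first by rewrite mulr_ge0 ?invr_ge0 ?ltW.
have := commuting_contraction_form dot A y s K A_pos KP (ltW K0).
move=> /(_ _ _ _ _ _ h); rewrite yY linearZ /= !re_dotE => le1.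
rewrite -mulrA ler_pdivlMl // ler_pdivlMl //; apply: le1.
- by move=> x; rewrite !yY linearZ /= AY.
- by move=> x; rewrite !sS linearZ /= AS.
- by move=> x z; rewrite yY sS !re_dotE (adjoint_re _ _ _ YS).
- move=> x; rewrite yY !re_dotE; apply: contr (sq_ge0 _ _) (K1P x) K10 _; lra.
- move=> x; rewrite sS !re_dotE; apply: contr (sq_ge0 _ _) (K2P x) K20 _; lra.
Qed.

Hypothesis A_neq0 : (A : H -> H) <> 0.

Lemma form_unit : exists h, <<A h, h>> = 1.
Proof.
have [h Ah] : exists h, A h <> 0.
  by apply/existsNP => A0; apply: A_neq0; apply/funext.
have q0 : 0 < <<A h, h>>.
  by rewrite lt_neqAle A_pos andbT eq_sym; apply/eqP => /form_eq0.
exists ((Num.sqrt <<A h, h>>)^-1%:C *: h); rewrite linearZ /= !re_dotE.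
by rewrite mulrA -invfM -expr2 sqr_sqrtr ?ltW // mulVf ?gt_eqF.
Qed.

(** The supremum only sees vectors of seminorm 1. By scaling it bounds all vectors of
    nonzero seminorm; a vector h of seminorm 0 must be sent to one of seminorm 0,
    since otherwise T would be unbounded on the line h0 + r h, on which the seminorm
    is constantly 1. *)
Lemma semiboundedP T : semibounded dot M A T <-> M T /\ form_bounded T.
Proof.
split=> -[MT]; last first.
  move=> [C C0 CP]; split=> //; apply: (@le_lt_trans _ _ (Num.sqrt C)%:E).
    apply: ge_ereal_sup => _ [h h1 <-]; rewrite lee_fin.
    apply: ler_wsqrtr; apply: le_trans (CP h) _.
    have -> : <<A h, h>> = 1; last by rewrite mulr1.
    by rewrite -[LHS]sqr_sqrtr // -[Num.sqrt _]/(seminorm_by dot A h) h1 expr1n.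
  exact: ltry.
move=> sup_fin; split=> //.
have [t tE] := vN_linear _ _ M_vN _ MT; subst T.
have [C C0 CP] : exists2 C, 0 <= C & forall h, <<A h, h>> = 1 -> <<A (t h), t h>> <= C.
  have sup_ub h : <<A h, h>> = 1 ->
      ((seminorm_by dot A (t h))%:E <= op_seminorm_by dot A t)%E.
    move=> h1; apply: ereal_sup_ubound; exists h => //.
    by change (Num.sqrt <<A h, h>> = 1); rewrite h1 sqrtr1.
  have [h0 /sup_ub] := form_unit.
  move: sup_fin sup_ub; case: (op_seminorm_by dot A t) => [r _ rP _| |_ _]; last 2 first.
  - by rewrite ltxx.
  - by rewrite leeNy_eq.
  exists (r ^+ 2); first exact: sqr_ge0.
  move=> h /rP; rewrite lee_fin => le1.
  have r0 : 0 <= r := le_trans (sqrtr_ge0 _) le1.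
  by rewrite -[leLHS]sqr_sqrtr // ler_pXn2r // nnegrE sqrtr_ge0.
clear sup_fin; exists C => // h; have [q0|] := eqVneq <<A h, h>> 0; last first.
  move=> q0; have {}q0 : 0 < <<A h, h>> by rewrite lt_neqAle eq_sym q0 A_pos.
  have := CP ((Num.sqrt <<A h, h>>)^-1%:C *: h).
  rewrite !linearZ /= !re_dotE !mulrA -invfM -expr2 (sqr_sqrtr (ltW q0)).
  by rewrite mulVf ?gt_eqF // => /(_ erefl); rewrite ler_pdivrMl // mulrC.
rewrite q0 mulr0 leNgt; apply/negP => d0.
have Ah := form_eq0 _ q0; have [h0 h01] := form_unit.
set d := <<A (t h), t h>> in d0.
have bnd r : r * r * d <= 4 * C.
  have le1 := CP (h0 + r%:C *: h).
  have le2 := CP _ h01.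
  have {}le1 : <<A (t (h0 + r%:C *: h)), t (h0 + r%:C *: h)>> <= C.
    by apply: le1; rewrite linearD linearZ /= Ah scaler0 addr0 re_dotDr re_dotZr
      h01 A_sym Ah re_dotC re_dot0l mulr0 addr0.
  have := formD_le (t (h0 + r%:C *: h)) (- t h0).
  rewrite linearN re_dotNl re_dotNr opprK [t (_ + _)]linearD linearZ /=.
  rewrite addrAC subrr add0r linearZ /= re_dotZl re_dotZr -/d mulrA => le3.
  move: le1; rewrite [t (_ + _)]linearD linearZ /= linearD linearZ /=.
  by move: le3; rewrite linearD linearZ /=; lra.
(* With e = (4 C + 1) / d, the bound fails at e + 1: (e + 1)^2 d > e d > 4 C. *)
have := bnd ((4 * C + 1) / d + 1).
have e0 : 0 <= (4 * C + 1) / d by rewrite divr_ge0 ?ltW //; lra.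
have : (4 * C + 1) / d * d = 4 * C + 1 by rewrite divfK ?gt_eqF.
move: e0; set e := _ / d => e0 ed.
have -> : (e + 1) * (e + 1) * d = e * e * d + 2 * (e * d) + d by ring.
have := mulr_ge0 (mulr_ge0 e0 e0) (ltW d0).
by move: d0; rewrite ed; lra.
Qed.

End Positive.
End Forms.

(** * Polynomials in an operator *)

Section OpHorner.
Context {R : realType} {H : completeNormedModType R[i]}.
Variable T : {linear H -> H}.
Implicit Types (p q : {poly R[i]}) (h : H).

Lemma op_hornerE p h : op_horner p T h = \sum_(i < size p) p`_i *: iter i T h.
Proof. by rewrite /op_horner fct_sumE. Qed.

Lemma op_horner_widen n p h : (size p <= n)%N ->
  op_horner p T h = \sum_(i < n) p`_i *: iter i T h.
Proof.
move=> pn; rewrite op_hornerE (big_ord_widen n (fun i => p`_i *: iter i T h)) //.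
rewrite big_mkcond; apply: eq_bigr => i _; case: ltnP => // pi.
by rewrite nth_default ?scale0r.
Qed.

Lemma op_hornerD p q h : op_horner (p + q) T h = op_horner p T h + op_horner q T h.
Proof.
pose n := maxn (size p) (size q).
rewrite !(op_horner_widen n) ?leq_maxl ?leq_maxr ?size_polyD // -big_split.
by apply: eq_bigr => i _; rewrite coefD scalerDl.
Qed.

Lemma op_hornerZ a p h : op_horner (a *: p) T h = a *: op_horner p T h.
Proof.
rewrite (op_horner_widen (size p)) ?size_scale_leq // op_hornerE scaler_sumr.
by apply: eq_bigr => i _; rewrite coefZ scalerA.
Qed.

Lemma op_hornerC c h : op_horner c%:P T h = c *: h.
Proof. by rewrite (op_horner_widen 1) ?size_polyC_leq1 // big_ord1 coefC. Qed.

Lemma op_hornerMX p h : op_horner (p * 'X) T h = op_horner p T (T h).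
Proof.
rewrite (op_horner_widen (size p).+1); last first.
  by apply: leq_trans (size_polyMleq _ _) _; rewrite size_polyX addn2.
rewrite big_ord_recl coefMX eqxx scale0r add0r op_hornerE.
by apply: eq_bigr => i _; rewrite coefMX /= -iterS iterSr.
Qed.

Lemma op_horner_comm p h : op_horner p T (T h) = T (op_horner p T h).
Proof.
rewrite !op_hornerE linear_sum; apply: eq_bigr => i _.
by rewrite linearZ /= -iterS iterSr.
Qed.

Lemma op_horner_is_linear p : linear (op_horner p T).
Proof.
move=> a u v; rewrite !op_hornerE scaler_sumr -big_split; apply: eq_bigr => i _ /=.
have -> : iter i T (a *: u + v) = a *: iter i T u + iter i T v.
  by elim: (nat_of_ord i) => //= n ->; rewrite linearP.
by rewrite scalerDr !scalerA mulrC.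
Qed.

Lemma op_hornerMXsubC p l h :
  op_horner (p * ('X - l%:P)) T h = op_horner p T (T h) - l *: op_horner p T h.
Proof.
rewrite mulrBr mulrC [p * _]mulrC mul_polyC -scaleNr op_hornerD mulrC.
by rewrite op_hornerMX op_hornerZ scaleNr.
Qed.

(** A class of operators closed under the algebra operations contains the polynomials
    in its elements; used for membership in M and for boundedness. *)
Lemma op_horner_ind (K : (H -> H) -> Prop) p :
  K idfun -> (forall S S', K S -> K S' -> K (S + S')) ->
  (forall a S, K S -> K (a *: S)) -> (forall S S', K S -> K S' -> K (S \o S')) ->
  K T -> K (op_horner p T).
Proof.
move=> K1 KD KZ KM KT; elim/poly_ind: p => [|p c IH].
  have -> : op_horner 0 T = 0 *: idfun :> (H -> H).
    by apply/funext => h; rewrite op_hornerE size_poly0 big_ord0 fctE scale0r.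
  exact: KZ.
have -> : op_horner (p * 'X + c%:P) T = op_horner p T \o T + c *: idfun.
  by apply/funext => h; rewrite op_hornerD op_hornerMX op_hornerC.
by apply: KD; [exact: KM|exact: KZ].
Qed.

(** Let D = l - T. Write a polynomial killing T as q * (X - l)^m with q(l) != 0.
    Since P D u = 0 implies P u = Y (P D u) = 0, the factors D can be cancelled and
    P q(T) = 0. Dividing q - q(l) by X - l exhibits q(l) P as P s(T) D. *)
Lemma algebraic_left_inverse (P Y : H -> H) (l : R[i]) : linear P -> Y 0 = 0 ->
  (forall h, Y (P (l *: h - T h)) = P h) -> algebraic_op T ->
  exists p, forall h, P (op_horner p T (l *: h - T h)) = P h.
Proof.
move=> Plin Y0 YP [p p0 pT]; have [f Ef] := linear_lift _ Plin; subst P.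
have [m [q q0 pE]] := multiplicity_XsubC p l.
rewrite p0 /= in q0.
have cancel u : f (T u - l *: u) = 0 -> f u = 0.
  by rewrite -opprB linearN => /eqP; rewrite oppr_eq0 -(YP u) => /eqP ->.
have {m p p0 pT pE} fq h : f (op_horner q T h) = 0.
  have : forall h, f (op_horner p T h) = 0 by move=> k; rewrite pT linear0.
  rewrite pE; elim: m {pE} h => [|m IH] h; first by rewrite expr0 mulr1.
  move=> fp; apply: IH => k; apply: cancel.
  by rewrite -op_horner_comm -op_hornerMXsubC -mulrA -exprSr fp.
have [s sE] : exists s, q - q.[l]%:P = s * ('X - l%:P).
  by apply/factor_theorem; rewrite /root !hornerE subrr.
have [g gE] := linear_lift _ (op_horner_is_linear s).
exists (q.[l]^-1 *: s) => h; rewrite op_hornerZ gE.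
have qE : q.[l] *: h = op_horner q T h - (g (T h) - l *: g h).
  by rewrite -gE -op_hornerMXsubC -sE op_hornerD -polyCN op_hornerC scaleNr subKr.
have gP : f (g (l *: h - T h)) = q.[l] *: f h.
  have <- : f (q.[l] *: h) = q.[l] *: f h by rewrite linearZ.
  by rewrite qE [RHS]linearB fq sub0r -linearN opprB [g (_ - _)]linearB
    [g (l *: h)]linearZ.
by rewrite linearZ /= gP scalerA mulVf ?scale1r.
Qed.

End OpHorner.

(** * Comparison of the spectra *)

Section Spectra.
Context {R : realType} {H : completeNormedModType R[i]}.
Variable dot : {dot H for Num.conj}.
Hypothesis dot_norm : induces_norm dot.
Variable A : {linear H -> H}.
Hypothesis A_sym : re_symmetric dot A.
Hypothesis A_pos : forall h, 0 <= re_dot dot (A h) h.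
Hypothesis A_neq0 : (A : H -> H) <> 0.
Variable P : {linear H -> H}.
Hypothesis P_proj : orthogonal_projection dot (closure (range A)) P.

Let AP h : A (P h) = A h := A_proj dot A P A_sym P_proj h.
Let PK h : P (P h) = P h := projK dot dot_norm A P A_sym P_proj h.
Let P_eq h k : A h = A k -> P h = P k := proj_eq dot dot_norm A P A_sym P_proj h k.

Section Compression.
Variables (T : {linear H -> H}) (l : R[i]).
Hypothesis T_ker : forall h, A h = 0 -> A (T h) = 0.

Let D h := l *: h - T h.

(** P D = P D P: the difference h - P h is in ker A, which D preserves. *)
Lemma resolvent_P h : P (D (P h)) = P (D h).
Proof.
apply: P_eq; apply/eqP; rewrite -subr_eq0 -linearB /D.
have -> : l *: P h - T (P h) - (l *: h - T h) = l *: (P h - h) - T (P h - h).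
  by rewrite scalerBr [T (_ - _)]linearB !opprB [T h - l *: h]addrC
    [T h - T _]addrC addrACA.
have Ah : A (P h - h) = 0 by rewrite linearB /= AP subrr.
by rewrite linearB linearZ /= Ah scaler0 T_ker ?subrr.
Qed.

Lemma resolventE h : (l *: (P : H -> H) - (P \o T)) h = P (D h).
Proof. by rewrite fctE /D linearB linearZ. Qed.

(** The compression P S P of an A-inverse S is an inverse in the corner. *)
Lemma semi_inverse_to_corner (M : set (H -> H)) S : M S ->
  (forall h, A h = 0 -> A (S h) = 0) -> linear S ->
  A \o (l *: (idfun : H -> H) - (T : H -> H)) \o S = A ->
  A \o S \o (l *: (idfun : H -> H) - (T : H -> H)) = A ->
  exists2 Y, corner P M Y &
    (l *: (P : H -> H) - (P \o T)) \o Y = P /\ Y \o (l *: (P : H -> H) - (P \o T)) = P.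
Proof.
move=> MS S_ker Sl ADS ASD; have [s sE] := linear_lift _ Sl; subst S.
exists (P \o s \o P); first by exists s.
split; apply/funext => h.
  rewrite /= resolventE resolvent_P -[RHS]PK; apply: P_eq.
  exact: (congr1 (fun f => f (P h)) ADS).
rewrite -[LHS]/(P (s (P ((l *: (P : H -> H) - (P \o T)) h)))) resolventE PK.
apply: P_eq; rewrite -[RHS](congr1 (fun f => f h) ASD) /=.
have Ad : A (P (D h) - D h) = 0 by rewrite linearB /= AP subrr.
have := S_ker _ Ad; rewrite linearB linearB /= => /eqP; rewrite subr_eq0 => /eqP ->.
by [].
Qed.

Lemma corner_inverse_spec Z Y : Y = P \o Z \o P ->
  (l *: (P : H -> H) - (P \o T)) \o Y = P ->
  Y \o (l *: (P : H -> H) - (P \o T)) = P ->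
  [/\ forall h, Y (P h) = Y h, forall h, P (Y h) = Y h,
      forall h, A (D (Y h)) = A h & forall h, Y (D h) = P h].
Proof.
move=> -> XY YX; split=> h /=; rewrite ?PK //.
  have /(congr1 A) := congr1 (fun f => f h) XY.
  by rewrite /= resolventE !AP.
by have := congr1 (fun f => f h) YX; rewrite /= resolventE PK.
Qed.

End Compression.

Section OneAlgebra.
Variable M : set (H -> H).
Hypothesis M_vN : von_neumann_algebra dot M.
Hypothesis MA : M A.

Let sbP S : semibounded dot M A S <-> M S /\ form_bounded dot A S :=
  semiboundedP dot dot_norm M M_vN A MA A_sym A_pos A_neq0 S.

Let MP : M P := vN_projection dot dot_norm M M_vN A MA A_sym A_pos P P_proj.

(** The inclusion that holds for every T preserving ker A is proved here; the other one
    is left as a hypothesis, since an inverse Y in the corner need not be bounded for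
    the seminorm of A. *)
Lemma semi_spectrum_corner (T : {linear H -> H}) :
  (forall h, A h = 0 -> A (T h) = 0) ->
  (forall l Y, M Y -> linear Y -> (forall h, Y (P h) = Y h) ->
     (forall h, P (Y h) = Y h) ->
     (forall h, A (l *: Y h - T (Y h)) = A h) ->
     (forall h, Y (l *: h - T h) = P h) ->
     semi_invertible dot M A (l *: (idfun : H -> H) - (T : H -> H))) ->
  semi_spectrum dot M A T = spectrum_in (corner P M) P (P \o T).
Proof.
move=> T_ker inv; apply/funext => l; apply/propext; split=> nl il; apply: nl.
  case: il => Y [Z MZ ZY] [XY YX].
  have MY : M Y.
    by rewrite -ZY; apply: (vN_comp M_vN) => //; apply: (vN_comp M_vN).
  have [Yb1 Yb2 Yb3 Yb4] := corner_inverse_spec T l Z Y (esym ZY) XY YX.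
  by apply: (inv l Y) => //; have [] := vN_bounded M_vN MY.
case: il => S /sbP[MS S_bnd] [ADS ASD].
apply: (semi_inverse_to_corner T l T_ker M S) => //.
  move=> h; exact: (form_bounded_ker dot dot_norm M M_vN).
by have [] := vN_bounded M_vN MS.
Qed.

(** The inverse Y commutes with A: as D commutes with A,
    Y A h = Y A D Y h = Y D A Y h = P A Y h = A Y h. *)
Lemma commutant_semi_spectrum T : commutant_in M A T ->
  semi_spectrum dot M A T = spectrum_in (corner P M) P (P \o T).
Proof.
move=> [MT TA]; have [t tE] := vN_linear _ _ M_vN _ MT; subst T.
have tA h : A (t h) = t (A h) by rewrite -[RHS]/((t \o A) h) TA.
apply: semi_spectrum_corner => [h Ah|l Y MY Yl YP PY ADY YD].
  by rewrite tA Ah linear0.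
exists Y; last first.
  by split; apply/funext => h; [exact: ADY|rewrite -[RHS]AP -YD].
apply/sbP; split=> //; apply: (commutant_form_bounded dot dot_norm M M_vN) => //.
apply/funext => h /=.
rewrite -(ADY h) linearB linearZ /= tA YD.
exact: (proj_A dot dot_norm A P A_sym P_proj).
Qed.

(** The A-inverse is a polynomial in T, so it commutes with D and only one of the two
    identities has to be checked. *)
Lemma algebraic_semi_spectrum T : semibounded dot M A T -> algebraic_op T ->
  semi_spectrum dot M A T = spectrum_in (corner P M) P (P \o T).
Proof.
move=> /sbP[MT T_bnd] T_alg; have [t tE] := vN_linear _ _ M_vN _ MT; subst T.
apply: semi_spectrum_corner => [h|l Y MY Yl YP PY ADY YD].
  exact: (form_bounded_ker dot dot_norm M M_vN).
have [y yE] := linear_lift _ Yl; subst Y.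
have [|p pP] := algebraic_left_inverse t P y l (linearP P) (linear0 y) _ T_alg.
  by move=> h; rewrite YP YD.
have [s sE] := linear_lift _ (op_horner_is_linear t p).
exists s.
  apply/sbP; rewrite -sE; split.
    apply: op_horner_ind => //; first exact: (vN_id M_vN).
    - exact: (vN_add M_vN).
    - exact: (vN_scale M_vN).
    - exact: (vN_comp M_vN).
  apply: op_horner_ind => //; first exact: form_bounded_id.
  - exact: (form_boundedD dot A A_pos).
  - exact: form_boundedZ.
  - exact: form_bounded_comp.
have AsD h : A (s (l *: h - t h)) = A h by rewrite -AP -sE pP AP.
split; apply/funext => h; last exact: AsD.
by rewrite /= -[RHS]AsD [s (_ - _)]linearB [s (l *: h)]linearZ -sE op_horner_comm.
Qed.

Lemma spectral_permanence_corner (N : set (H -> H)) (T : H -> H) :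
  von_neumann_algebra dot N -> N A -> N `<=` M -> N T ->
  spectrum_in (corner P N) P (P \o T) = spectrum_in (corner P M) P (P \o T).
Proof.
move=> N_vN NA NM NT; apply/funext => l; apply/propext; split=> nl il; apply: nl.
  case: il => Y [Z MZ ZY] [XY YX].
  have NP : N P := vN_projection dot dot_norm N N_vN A NA A_sym A_pos P P_proj.
  have MY : M Y.
    by rewrite -ZY; apply: (vN_comp M_vN) => //; apply: (vN_comp M_vN).
  have YP : Y \o P = Y by rewrite -ZY; apply/funext => h /=; rewrite PK.
  have PY : P \o Y = Y by rewrite -ZY; apply/funext => h /=; rewrite PK.
  have [Y' _ YY'] := vN_adjoint M_vN MY.
  exists Y => //; exists Y; last by rewrite PY YP.
  apply: (vN_spectral_permanence dot dot_norm N N_vN P _ Y Y') XY YX YP PY => //.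
  - apply: (vN_sub _ _ N_vN); first exact: (vN_scale N_vN).
    exact: (vN_comp N_vN).
  - exact: (vN_bounded M_vN).
  - exact: (proj_symmetric dot A).
case: il => Y [Z NZ ZY] XYX; exists Y => //; exists Z => //; exact: NM.
Qed.

End OneAlgebra.
End Spectra.

Theorem theorem2p21 (R : realType) (H : completeNormedModType R[i])
  (dot : {dot H for Num.conj}) (dot_norm : induces_norm dot)
  (M : set (H -> H)) (M_vN : von_neumann_algebra dot M)
  (A : H -> H) (MA : M A) (A_neq0 : A <> 0) (A_pos : positive_op dot A)
  (P : H -> H) (P_proj : orthogonal_projection dot (closure (range A)) P) :
  ((forall T, commutant_in M A T ->
      semi_spectrum dot M A T = spectrum_in (corner P M) P (P \o T))
   /\
   (forall N : set (H -> H), von_neumann_algebra dot N -> N A -> N `<=` M ->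
      forall T, (commutant_in M A `&` N) T ->
        semi_spectrum dot M A T = semi_spectrum dot N A T))
  /\
  (forall T, semibounded dot M A T -> algebraic_op T ->
      semi_spectrum dot M A T = spectrum_in (corner P M) P (P \o T)).
Proof.
have [a aE] := vN_linear _ _ M_vN _ MA; subst A.
have a_sym : re_symmetric dot a.
  by move=> x y; rewrite /re_dot (positive_symmetric dot a (linearP a) A_pos).
have a_pos h : 0 <= re_dot dot (a h) h.
  by have := A_pos h; rewrite lecE => /andP[].
have [p pE] := linear_lift _ (proj_linear dot dot_norm a P a_sym P_proj); subst P.
split; [split|].
- move=> T; exact: (commutant_semi_spectrum dot dot_norm).
- move=> N N_vN NA NM T [[MT TA] NT].
  rewrite (commutant_semi_spectrum dot dot_norm a a_sym a_pos A_neq0 p P_proj M)//.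
  rewrite (commutant_semi_spectrum dot dot_norm a a_sym a_pos A_neq0 p P_proj N)//.
  by apply/esym/(spectral_permanence_corner dot dot_norm a).
- move=> T; exact: (algebraic_semi_spectrum dot dot_norm).
Qed.
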